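(* There exist infinitely many positive integers $n$ such that there is a (simple) $n$-vertex RAC$_1$ graph with exactly $5n-10$ edges.
   Context: Graphs are simple. A $1$-bend right-angle-crossing drawing (RAC$_1$ drawing) of a graph is a drawing in the plane in which vertices are mapped to distinct points, each edge is drawn as a polygonal curve between its endpoints with at most one bend (and not passing through any other vertex), and whenever two edges cross, they cross at a right angle ($90^\circ$). A graph is a RAC$_1$ graph if it admits a RAC$_1$ drawing. *)

(* Defs.v *)
From Stdlib Require Import Reals.
From mathcomp Require Import all_boot.

Set Implicit Arguments.
Unset Strict Implicit.
Unset Printing Implicit Defensive.

Local Open Scope R_scope.
Definition pt : Type := (R * R)%type.

Definition on_seg (a b x : pt) : Prop :=
  exists t : R, Rle R0 t /\ Rle t R1 /\
    fst x = Rplus (fst a) (Rmult t (Rminus (fst b) (fst a))) /\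
    snd x = Rplus (snd a) (Rmult t (Rminus (snd b) (snd a))).

Definition perp (a b c d : pt) : Prop :=
  Rplus (Rmult (Rminus (fst b) (fst a)) (Rminus (fst d) (fst c)))
        (Rmult (Rminus (snd b) (snd a)) (Rminus (snd d) (snd c))) = R0.

Local Close Scope R_scope.
Definition simple_graph (n : nat) (E : rel 'I_n) : Prop :=
  irreflexive E /\ symmetric E.

Definition is_edge (n : nat) (E : rel 'I_n) (u v : 'I_n) : bool :=
  ((u < v)%N && E u v).

Definition num_edges (n : nat) (E : rel 'I_n) : nat :=
  #|[set p : 'I_n * 'I_n | is_edge E p.1 p.2]|.

(* The two straight pieces of the polyline drawing edge (u,v):
   pos u -> bend u v -> pos v.  Taking bend u v on the segment (or equal
   to an endpoint) gives a straight-line edge, so "at most one bend". *)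
Definition piece (n : nat) (pos : 'I_n -> pt) (bend : 'I_n -> 'I_n -> pt)
  (u v : 'I_n) (i : bool) : pt * pt :=
  if i then (pos u, bend u v) else (bend u v, pos v).

Definition RAC1_drawing (n : nat) (E : rel 'I_n)
  (pos : 'I_n -> pt) (bend : 'I_n -> 'I_n -> pt) : Prop :=
  injective pos /\
  (forall u v, is_edge E u v -> forall w : 'I_n, w <> u -> w <> v ->
     forall i : bool, ~ on_seg (piece pos bend u v i).1 (piece pos bend u v i).2 (pos w)) /\
  (forall u v, is_edge E u v -> forall x : pt,
     on_seg (pos u) (bend u v) x -> on_seg (bend u v) (pos v) x -> x = bend u v) /\
  (forall u v u' v', is_edge E u v -> is_edge E u' v' -> (u, v) <> (u', v') ->
     forall (i j : bool) (x : pt),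
       on_seg (piece pos bend u v i).1 (piece pos bend u v i).2 x ->
       on_seg (piece pos bend u' v' j).1 (piece pos bend u' v' j).2 x ->
       (exists w : 'I_n, (w = u \/ w = v) /\ (w = u' \/ w = v') /\ x = pos w)
       \/ perp (piece pos bend u v i).1 (piece pos bend u v i).2
               (piece pos bend u' v' j).1 (piece pos bend u' v' j).2).

Definition RAC1_graph (n : nat) (E : rel 'I_n) : Prop :=
  exists (pos : 'I_n -> pt) (bend : 'I_n -> 'I_n -> pt), RAC1_drawing E pos bend.

(* Main.v *)
(* A stack of m dodecahedra, each glued to the next along a pentagon, has 15m + 5
   vertices, 25m + 5 edges and 10m + 2 pentagonal faces; adding all five diagonals
   of every face gives 75m + 15 = 5 (15m + 5) - 10 edges.

   A pentagonal face is filled as follows.  Choose on each side ab a point X with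
   aX and Xb perpendicular; the diagonal that cuts off the vertex b leaves its ends
   along the two lines so chosen for the sides ab and bc, and bends where they meet.
   The diagonals starting at the two ends of a side then cross at the point X of that
   side, at a right angle, and these are the only crossings if the angles are suitable.
   For a regular pentagon 45 degrees everywhere works, both inside and outside.

   The stack is drawn around the origin, consecutive pentagons being related by the
   homothety of ratio -30.  By self-similarity, edges of the same or of consecutive
   layers are dealt with by a finite computation with integers; layers further apart
   are separated by their distances to the origin in the maximum norm. *)
Require Import Defs.
From Stdlib Require Import Reals ZArith Lra Lia.
From mathcomp Require Import all_boot.

Set Implicit Arguments.
Unset Strict Implicit.
Unset Printing Implicit Defensive.

Delimit Scope R_scope with Re.

(** * Separation of segments in the real plane *)

Definition cross (a b c : pt) : R :=
  ((b.1 - a.1) * (c.2 - a.2) - (b.2 - a.2) * (c.1 - a.1))%Re.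

Definition dot (a b c d : pt) : R :=
  ((b.1 - a.1) * (d.1 - c.1) + (b.2 - a.2) * (d.2 - c.2))%Re.

Lemma dot_ge0 (a b : pt) : (0 <= dot a b a b)%Re.
Proof. exact: (Rplus_le_le_0_compat _ _ (Rle_0_sqr _) (Rle_0_sqr _)). Qed.

Lemma on_seg_sym (a b x : pt) : on_seg a b x -> on_seg b a x.
Proof.
move=> [t [t0 [t1 [ex ey]]]]; exists (1 - t)%Re; rewrite ex ey.
by split; [lra|split; [lra|split; ring]].
Qed.

Lemma convex_combination_pos (u v t : R) :
  (0 <= t <= 1 -> 0 < u -> 0 < v -> 0 < (1 - t) * u + t * v)%Re.
Proof.
move=> t01 u0 v0; case: (Rle_lt_dec t (/ 2)) => ht.
  by have := Rmult_lt_0_compat (1 - t) u; have := Rmult_le_pos t v; lra.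
by have := Rmult_le_pos (1 - t) u; have := Rmult_lt_0_compat t v; lra.
Qed.

Lemma on_seg_cross (a b x : pt) : on_seg a b x -> cross a b x = 0%Re.
Proof. by move=> [t [_ [_ [ex ey]]]]; rewrite /cross ex ey; ring. Qed.

(** The affine function [cross a b] vanishes on the line ab and keeps one strict sign on the segment
    cd. *)
Lemma same_side_disjoint (a b c d x : pt) :
  (0 < cross a b c * cross a b d)%Re -> on_seg a b x -> on_seg c d x -> False.
Proof.
move=> h /on_seg_cross x0 [t [t0 [t1 [ex ey]]]].
have e : cross a b x = ((1 - t) * cross a b c + t * cross a b d)%Re.
  by rewrite /cross ex ey; ring.
case: (Rtotal_order (cross a b c) 0) => [c0|[c0|c0]].
- have d0 : (cross a b d < 0)%Re by nra.
  have := @convex_combination_pos (- cross a b c) (- cross a b d) t (conj t0 t1)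
    ltac:(lra) ltac:(lra); lra.
- by rewrite c0 in h; lra.
- have d0 : (0 < cross a b d)%Re by nra.
  have := @convex_combination_pos (cross a b c) (cross a b d) t (conj t0 t1)
    ltac:(lra) ltac:(lra); lra.
Qed.

(** Measured from [b] in the direction of ab, points of ab have nonpositive coordinate and points of
    cd positive coordinate. *)
Lemma beyond_disjoint (a b c d x : pt) :
  (0 < dot a b b c)%Re -> (0 < dot a b b d)%Re ->
  on_seg a b x -> on_seg c d x -> False.
Proof.
move=> hc hd [r [r0 [r1 [ex ey]]]] [t [t0 [t1 [ex' ey']]]].
have e : dot a b b x = ((1 - t) * dot a b b c + t * dot a b b d)%Re.
  by rewrite /dot ex' ey'; ring.
have e' : dot a b b x = (- ((1 - r) * dot a b a b))%Re.
  by rewrite /dot ex ey; ring.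
have ab0 := dot_ge0 a b.
have := @convex_combination_pos (dot a b b c) (dot a b b d) t (conj t0 t1)
    ltac:(lra) ltac:(lra).
have := Rmult_le_pos (1 - r) (dot a b a b) ltac:(lra) ab0; lra.
Qed.

(** If pb and pc are not parallel, the lines meet only at [p]; if their angle exceeds 90 degrees,
    the product of x - p with b - p is both nonnegative and nonpositive. This serves for two edges
    at a common vertex and for the two halves of an edge at its bend. *)
Lemma hinge_meet (p b c x : pt) :
  cross p b c <> 0%Re \/ (dot p b p c < 0)%Re ->
  on_seg p b x -> on_seg p c x -> x = p.
Proof.
move=> h [r [r0 [r1 [ex ey]]]] [t [t0 [t1 [ex' ey']]]].
have r00 : r = 0%Re \/ (t = 0)%Re.
  case: h => h.
    right.
    have: (t * cross p b c = 0)%Re.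
      have -> : (t * cross p b c = cross p b x)%Re by rewrite /cross ex' ey'; ring.
      by rewrite /cross ex ey; ring.
    by move/Rmult_integral => [].
  have bb0 := dot_ge0 p b.
  have e : (r * dot p b p b = t * dot p b p c)%Re.
    transitivity (dot p b p x); first by rewrite /dot ex ey; ring.
    by rewrite /dot ex' ey'; ring.
  right; have := Rmult_le_pos r (dot p b p b) r0 bb0.
  nra.
by case: r00 => h0; [move: ex ey|move: ex' ey']; rewrite h0 !Rmult_0_l !Rplus_0_r;
   case: (x) (p) => [? ?] [? ?] /= -> ->.
Qed.

(** * Integer tests for pairs of segments *)

(* Homogeneous integer coordinates: (x, y, w) stands for (x / w, y / w), with w > 0. *)
Definition hpt : Type := (Z * Z * Z)%type.

Definition det (a b c : hpt) : Z :=
  let: (xa, ya, wa) := a in let: (xb, yb, wb) := b in let: (xc, yc, wc) := c in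
  ((xb * wa - xa * wb) * (yc * wa - ya * wc)
   - (yb * wa - ya * wb) * (xc * wa - xa * wc))%Z.

Definition hdot (a b c d : hpt) : Z :=
  let: (xa, ya, wa) := a in let: (xb, yb, wb) := b in
  let: (xc, yc, wc) := c in let: (xd, yd, wd) := d in
  ((xb * wa - xa * wb) * (xd * wc - xc * wd)
   + (yb * wa - ya * wb) * (yd * wc - yc * wd))%Z.

Definition affine (a : hpt) : bool := (0 <? a.2)%Z.

Definition emb (s : R) (a : hpt) : pt :=
  (s * IZR a.1.1 / IZR a.2, s * IZR a.1.2 / IZR a.2)%Re.

Lemma affine_gt0 (a : hpt) : affine a -> (0 < IZR a.2)%Re.
Proof. by move=> /Z.ltb_lt /IZR_lt. Qed.

(** Clearing the positive denominators leaves a factor in which [s] is squared, so signs survive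
    even a homothety of negative ratio. *)
Lemma cross_emb (s : R) (a b c : hpt) : s <> 0%Re ->
  affine a -> affine b -> affine c ->
  exists2 k : R, (0 < k)%Re &
    cross (emb s a) (emb s b) (emb s c) = (k * IZR (det a b c))%Re.
Proof.
move: a b c => [[xa ya] wa] [[xb yb] wb] [[xc yc] wc] s0.
move=> /affine_gt0 /= a0 /affine_gt0 /= b0 /affine_gt0 /= c0.
exists (s * s / (IZR wa * IZR wa * IZR wb * IZR wc))%Re.
  apply: Rdiv_lt_0_compat; first by nra.
  by do ?apply: Rmult_lt_0_compat.
rewrite /cross /emb /=.
rewrite !(minus_IZR, mult_IZR).
field; lra.
Qed.

Lemma dot_emb (s : R) (a b c d : hpt) : s <> 0%Re ->
  affine a -> affine b -> affine c -> affine d ->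
  exists2 k : R, (0 < k)%Re &
    dot (emb s a) (emb s b) (emb s c) (emb s d) = (k * IZR (hdot a b c d))%Re.
Proof.
move: a b c d => [[xa ya] wa] [[xb yb] wb] [[xc yc] wc] [[xd yd] wd] s0.
move=> /affine_gt0 /= a0 /affine_gt0 /= b0 /affine_gt0 /= c0 /affine_gt0 /= d0.
exists (s * s / (IZR wa * IZR wb * IZR wc * IZR wd))%Re.
  apply: Rdiv_lt_0_compat; first by nra.
  by do ?apply: Rmult_lt_0_compat.
rewrite /dot /emb /=.
rewrite !(plus_IZR, minus_IZR, mult_IZR).
field; lra.
Qed.

(* Half of an edge: the number of its end vertex, that vertex, and the bend. *)
Definition half : Type := (nat * hpt * hpt)%type.

Definition half_seg (s : R) (h : half) (x : pt) : Prop :=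
  on_seg (emb s h.1.2) (emb s h.2) x.

Definition half_affine (h : half) : bool := affine h.1.2 && affine h.2.

Definition same_side (a b c d : hpt) : bool :=
  match det a b c with
  | Z0 => false
  | Zpos _ => (0 <? det a b d)%Z
  | Zneg _ => (det a b d <? 0)%Z
  end.

(* c and d lie beyond the end b of the segment ab; this separates collinear segments,
   for which [same_side] fails. *)
Definition beyond (a b c d : hpt) : bool :=
  (0 <? hdot a b b c)%Z && (0 <? hdot a b b d)%Z.

Definition separated (h g : half) : bool :=
  [|| same_side h.1.2 h.2 g.1.2 g.2, same_side g.1.2 g.2 h.1.2 h.2,
      beyond h.1.2 h.2 g.1.2 g.2 | beyond h.2 h.1.2 g.1.2 g.2].

Definition hinge (p b c : hpt) : bool :=
  ~~ (det p b c =? 0)%Z || (hdot p b p c <? 0)%Z.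

(** A certificate for the crossing clause of [RAC1_drawing]. That clause asks for a common vertex,
    hence the comparison of vertex numbers. *)
Definition compatible (h g : half) : bool :=
  [|| separated h g, (hdot h.1.2 h.2 g.1.2 g.2 =? 0)%Z
    | (h.1.1 == g.1.1) && hinge h.1.2 h.2 g.2].

Lemma same_side_sound (s : R) (a b c d : hpt) (x : pt) : s <> 0%Re ->
  affine a -> affine b -> affine c -> affine d -> same_side a b c d ->
  on_seg (emb s a) (emb s b) x -> on_seg (emb s c) (emb s d) x -> False.
Proof.
move=> s0 pa pb pc pd h; apply: same_side_disjoint.
have [k k0 ->] := cross_emb s0 pa pb pc.
have [l l0 ->] := cross_emb s0 pa pb pd.
suff : (0 < IZR (det a b c) * IZR (det a b d))%Re.
  by move=> m0; have := Rmult_lt_0_compat _ _ (Rmult_lt_0_compat _ _ k0 l0) m0; lra.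
move: h; rewrite /same_side -mult_IZR.
case: (det a b c) => // q /Z.ltb_lt h; apply: IZR_lt; nia.
Qed.

Lemma beyond_sound (s : R) (a b c d : hpt) (x : pt) : s <> 0%Re ->
  affine a -> affine b -> affine c -> affine d -> beyond a b c d ->
  on_seg (emb s a) (emb s b) x -> on_seg (emb s c) (emb s d) x -> False.
Proof.
move=> s0 pa pb pc pd /andP[/Z.ltb_lt /IZR_lt hc /Z.ltb_lt /IZR_lt hd].
by apply: beyond_disjoint;
  [have [k k0 ->] := dot_emb s0 pa pb pb pc|have [k k0 ->] := dot_emb s0 pa pb pb pd];
  apply: Rmult_lt_0_compat.
Qed.

Lemma separated_sound (s : R) (h g : half) (x : pt) : s <> 0%Re ->
  half_affine h -> half_affine g -> separated h g ->
  half_seg s h x -> half_seg s g x -> False.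
Proof.
move=> s0 /andP[h1 h2] /andP[g1 g2] /or4P[] sep hx gx.
- exact: same_side_sound sep hx gx.
- exact: same_side_sound sep gx hx.
- exact: beyond_sound sep hx gx.
- exact: beyond_sound sep (on_seg_sym hx) gx.
Qed.

Lemma hinge_sound (s : R) (p b c : hpt) (x : pt) : s <> 0%Re ->
  affine p -> affine b -> affine c -> hinge p b c ->
  on_seg (emb s p) (emb s b) x -> on_seg (emb s p) (emb s c) x -> x = emb s p.
Proof.
move=> s0 pp pb pc h; apply: hinge_meet.
case/orP: h => h; [left|right].
  have [k k0 ->] := cross_emb s0 pp pb pc.
  move/Rmult_integral => [|/eq_IZR_R0 d0]; first by lra.
  by rewrite d0 in h.
have [k k0 ->] := dot_emb s0 pp pb pp pc.
move/Z.ltb_lt/IZR_lt: h => h; nra.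
Qed.

Lemma compatible_sound (s : R) (h g : half) (x : pt) : s <> 0%Re ->
  half_affine h -> half_affine g -> (h.1.1 = g.1.1 -> h.1.2 = g.1.2) ->
  compatible h g -> half_seg s h x -> half_seg s g x ->
  h.1.1 = g.1.1 /\ x = emb s h.1.2 \/
  perp (emb s h.1.2) (emb s h.2) (emb s g.1.2) (emb s g.2).
Proof.
move=> s0 hp gp idP c hx gx; have [h1 h2] := andP hp; have [g1 g2] := andP gp.
case/or3P: c => [sep|/Z.eqb_eq d0|/andP[/eqP id hg]].
- by case: (separated_sound s0 hp gp sep hx gx).
- right; have [k k0 e] := dot_emb s0 h1 h2 g1 g2.
  by rewrite /perp; move: e; rewrite /dot d0 Rmult_0_r.
- left; split=> //; apply: (hinge_sound s0 h1 h2 g2 hg hx).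
  by rewrite (idP id).
Qed.

(** * Coordinates of the stack of dodecahedra *)

Definition lambda : Z := (-30)%Z.

Definition hscale (k : Z) (a : hpt) : hpt :=
  ((k * a.1.1)%Z, (k * a.1.2)%Z, a.2).

(* A regular pentagon, up to rounding. *)
Definition pentagon : seq (Z * Z) :=
  [:: (0, 100); (-95, 31); (-59, -81); (59, -81); (95, 31)]%Z.

(** A dodecahedron seen through a face has its two outer rings half a turn away from the two inner
    ones: hence the signs of -10 and of [lambda], which gives the closing pentagon the factor
    -60. *)
Definition ring_radius : seq Z := [:: 2; 5; -10]%Z.

Definition base_vertex (j : nat) : hpt :=
  let p := nth (0, 0)%Z pentagon (j %% 5) in
  hscale (nth 0%Z ring_radius (j %/ 5)) (p, 1%Z).

(* Vertex 15 q + 5 c + k is the k-th vertex of the c-th ring of layer q; the 0-th ring is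
   the pentagon shared with layer q - 1, so 15, ..., 19 also close layer 0. *)
Definition vertex (j : nat) : hpt :=
  hscale (lambda ^ Z.of_nat (j %/ 15)) (base_vertex (j %% 15)).

Definition edge : Type := (nat * nat * hpt)%type.

Definition mk_edge (i j : nat) (b : hpt) : edge :=
  if (i < j)%N then (i, j, b) else (j, i, b).

(* This and the following constructions need no correctness proof: what matters of the
   resulting bends is checked by computation. *)
Definition reduce (a : hpt) : hpt :=
  let g := (Z.sgn a.2 * Z.gcd a.2 (Z.gcd a.1.1 a.1.2))%Z in
  ((a.1.1 / g)%Z, (a.1.2 / g)%Z, (a.2 / g)%Z).

Definition straight (i j : nat) : edge :=
  let a := vertex i in let b := vertex j in
  mk_edge i j (reduce ((a.1.1 + b.1.1)%Z, (a.1.2 + b.1.2)%Z, 2%Z)).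

(** Cramer's rule for the line through [a] with direction [d] and the line through [b] with
    direction [e]. *)
Definition meet (a d b e : Z * Z) : hpt :=
  let k := (d.1 * e.2 - d.2 * e.1)%Z in
  let u := ((b.1 - a.1) * e.2 - (b.2 - a.2) * e.1)%Z in
  reduce ((k * a.1 + u * d.1)%Z, (k * a.2 + u * d.2)%Z, k).

(* The direction at a making with ab the angle of tangent t.1 / t.2. *)
Definition tilt (t a b : Z * Z) : Z * Z :=
  let dx := (b.1 - a.1)%Z in let dy := (b.2 - a.2)%Z in
  (t.2 * dx - t.1 * dy, t.2 * dy + t.1 * dx)%Z.

(* The i-th tilt describes the right angle chosen over the i-th side of the face f, which is
   listed counterclockwise around its interior. *)
Definition diagonals (f : seq nat) (ts : seq (Z * Z)) : seq edge :=
  [seq (let u := nth 0 f i in let v := nth 0 f ((i + 1) %% 5) in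
        let w := nth 0 f ((i + 2) %% 5) in
        let a := (vertex u).1 in let b := (vertex v).1 in let c := (vertex w).1 in
        let d := tilt (nth (0, 0)%Z ts i) a b in
        let e := tilt (nth (0, 0)%Z ts ((i + 1) %% 5)) b c in
        mk_edge u w (meet a d c (- e.2, e.1)%Z)) | i <- iota 0 5].

Definition rim : seq edge := [seq straight k ((k + 1) %% 5) | k <- iota 0 5].

Definition unit_tilts : seq (Z * Z) := nseq 5 (1, 1)%Z.

(* The tilts, like the ring radii and [lambda], come from a numerical search. *)
Definition sector (k : nat) : seq edge :=
  let k1 := (k + 1) %% 5 in let k2 := (k + 2) %% 5 in let k3 := (k + 3) %% 5 in
  [:: straight k (5 + k); straight (5 + k) (10 + k2);
      straight (5 + k) (10 + k3); straight (10 + k) (15 + k)]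
  ++ diagonals [:: k1; k; 5 + k; 10 + k3; 5 + k1]
       [:: (1, 1); (3, 2); (5, 2); (2, 5); (2, 3)]%Z
  ++ diagonals [:: 15 + k2; 15 + k3; 10 + k3; 5 + k; 10 + k2]
       [:: (1, 1); (1, 12); (6, 5); (5, 6); (12, 1)]%Z.

(* The pentagon closing a layer counts as the rim of the next one. *)
Definition layer : seq edge := rim ++ flatten [seq sector k | k <- iota 0 5].

Definition inner_cap : seq edge := diagonals [:: 0; 1; 2; 3; 4] unit_tilts.

(** The pentagon is traversed backwards because the face to be filled is the unbounded one. *)
Definition outer_layer : seq edge :=
  rim ++ diagonals [:: 4; 3; 2; 1; 0] unit_tilts.

(** * Finite checks on one layer or two consecutive layers *)

Definition arm (e : edge) (i : bool) : half :=
  let k := if i then e.1.1 else e.1.2 in (k, vertex k, e.2).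

Definition raise (e : edge) : edge :=
  ((e.1.1 + 15, e.1.2 + 15), hscale lambda e.2).

Definition arms (e : edge) : half * half := (arm e true, arm e false).

Definition compatible_arms (a b : half * half) : bool :=
  [&& compatible a.1 b.1, compatible a.1 b.2, compatible a.2 b.1
    & compatible a.2 b.2].

Definition first_layer : seq edge := layer ++ inner_cap.

(** A degenerate half, so that the tests for segments also apply to single vertices. *)
Definition vertex_half (j : nat) : half := (j, vertex j, vertex j).

Definition avoids (vs : seq nat) (e : edge) : bool :=
  all (fun j => [|| j == e.1.1, j == e.1.2 |
    separated (arm e true) (vertex_half j) && separated (arm e false) (vertex_half j)]) vs.

(** The smaller end lies below 15, so division by 15 recovers the layer; the larger one may lie on
    the closing pentagon 15, ..., 19. The hinge keeps the two halves from meeting outside the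
    bend. *)
Definition well_formed (e : edge) : bool :=
  [&& (e.1.1 < e.1.2)%N, (e.1.1 < 15)%N, (e.1.2 < 20)%N, affine e.2
    & hinge e.2 (vertex e.1.1) (vertex e.1.2)].

Definition near_point (a : hpt) : bool :=
  (Z.abs a.1.1 <=? 10000 * a.2)%Z && (Z.abs a.1.2 <=? 10000 * a.2)%Z.

Definition near (h : half) : bool := near_point h.1.2 && near_point h.2.

(** Both ends must satisfy the same one of four inequalities, so that by convexity the whole half
    stays away from the origin. *)
Definition far (h : half) : bool :=
  has (fun f : hpt -> Z =>
         (60 * h.1.2.2 <=? f h.1.2)%Z && (60 * h.2.2 <=? f h.2)%Z)
    [:: (fun a => a.1.1); (fun a => - a.1.1)%Z; (fun a => a.1.2); (fun a => - a.1.2)%Z].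

Definition near_edge (e : edge) : bool := near (arm e true) && near (arm e false).
Definition far_edge (e : edge) : bool := far (arm e true) && far (arm e false).

Lemma first_layer_compatible : pairwise compatible_arms (map arms first_layer).
Proof. vm_cast_no_check (erefl true). Qed.

Lemma outer_layer_compatible : pairwise compatible_arms (map arms outer_layer).
Proof. vm_cast_no_check (erefl true). Qed.

(** As [first_layer] contains [layer], this covers all pairs of consecutive layers but the last.
    After [raise], both layers number the shared pentagon 15, ..., 19, so common ends are
    recognised. *)
Lemma layer_layer_compatible :
  allrel compatible_arms (map arms first_layer) (map arms (map raise layer)).
Proof. vm_cast_no_check (erefl true). Qed.

Lemma layer_outer_compatible :
  allrel compatible_arms (map arms first_layer) (map arms (map raise outer_layer)).
Proof. vm_cast_no_check (erefl true). Qed.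

Lemma first_layer_well_formed : all well_formed first_layer.
Proof. vm_cast_no_check (erefl true). Qed.

Lemma outer_layer_well_formed : all well_formed outer_layer.
Proof. vm_cast_no_check (erefl true). Qed.

Lemma outer_layer_lt5 : all (fun e => e.1.2 < 5)%N outer_layer.
Proof. vm_cast_no_check (erefl true). Qed.

(** The 30 vertices are those of the layer itself and of the next one; the raised checks below treat
    the vertices of the previous layer. *)
Lemma first_layer_avoids : all (avoids (iota 0 30)) first_layer.
Proof. vm_cast_no_check (erefl true). Qed.

Lemma outer_layer_avoids : all (avoids (iota 0 5)) outer_layer.
Proof. vm_cast_no_check (erefl true). Qed.

Lemma raised_layer_avoids : all (fun e => avoids (iota 0 15) (raise e)) layer.
Proof. vm_cast_no_check (erefl true). Qed.

Lemma raised_outer_layer_avoids :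
  all (fun e => avoids (iota 0 15) (raise e)) outer_layer.
Proof. vm_cast_no_check (erefl true). Qed.

Lemma first_layer_near : all near_edge first_layer.
Proof. vm_cast_no_check (erefl true). Qed.

Lemma layer_far : all far_edge layer.
Proof. vm_cast_no_check (erefl true). Qed.

Lemma outer_layer_far : all far_edge outer_layer.
Proof. vm_cast_no_check (erefl true). Qed.

Lemma vertices_near_far :
  all (fun j => near (vertex_half j) && far (vertex_half j)) (iota 0 15).
Proof. vm_cast_no_check (erefl true). Qed.

(** Meant for vertices, whose weight is always 1. *)
Definition same_point (a b : hpt) : bool :=
  (a.1.1 =? b.1.1)%Z && (a.1.2 =? b.1.2)%Z.

Lemma vertices_distinct :
  all (fun j => all (fun k => (j == k) || ~~ same_point (vertex j) (vertex k))
                    (iota 0 30)) (iota 0 30).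
Proof. vm_cast_no_check (erefl true). Qed.

Lemma first_layer_uniq : uniq [seq e.1 | e <- first_layer].
Proof. vm_cast_no_check (erefl true). Qed.

Lemma outer_layer_uniq : uniq [seq e.1 | e <- outer_layer].
Proof. vm_cast_no_check (erefl true). Qed.

Lemma size_layers :
  [/\ size first_layer = 80, size layer = 75 & size outer_layer = 10].
Proof. by split; vm_compute. Qed.

(** * Self-similarity, and separation of distant layers *)

Definition scale (q : nat) : R := IZR (lambda ^ Z.of_nat q).

Lemma scale_neq0 (q : nat) : scale q <> 0%Re.
Proof. by apply: not_0_IZR; apply: Z.pow_nonzero => //; exact: Zle_0_nat. Qed.

Lemma scaleS (q : nat) : scale q.+1 = (scale q * IZR lambda)%Re.
Proof.
by rewrite /scale Nat2Z.inj_succ Z.pow_succ_r ?mult_IZR ?(Rmult_comm (IZR lambda)) //;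
  exact: Zle_0_nat.
Qed.

(** Two layers give the factor 30 * 30 = 900, which exceeds the ratio 10000 / 60 of the bounds in
    [near] and [far]; a single factor 30 does not, so consecutive layers are checked explicitly. *)
Lemma scale_growth (q r : nat) : (q.+2 <= r)%N ->
  (900 * Rabs (scale q) <= Rabs (scale r))%Re.
Proof.
have abs_lambda : Rabs (IZR lambda) = 30%Re.
  by rewrite /lambda Rabs_left; lra.
move=> /subnKC <-; elim: (r - q.+2) => [|k IH].
  by rewrite addn0 !scaleS !Rabs_mult abs_lambda; lra.
rewrite addnS scaleS Rabs_mult abs_lambda.
by have := Rabs_pos (scale (q.+2 + k)); lra.
Qed.

Lemma emb_hscale (s : R) (k : Z) (a : hpt) :
  emb s (hscale k a) = emb (s * IZR k) a.
Proof. by rewrite /emb /hscale /= !mult_IZR !Rmult_assoc. Qed.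

Lemma hscale_mul (k l : Z) (a : hpt) : hscale k (hscale l a) = hscale (k * l) a.
Proof. by rewrite /hscale /= !Z.mul_assoc. Qed.

Lemma vertex_shift (q j : nat) :
  vertex (15 * q + j) = hscale (lambda ^ Z.of_nat q) (vertex j).
Proof.
rewrite /vertex mulnC divnMDl // modnMDl hscale_mul Nat2Z.inj_add.
by rewrite Z.pow_add_r //; exact: Zle_0_nat.
Qed.

Lemma emb_vertex_shift (s : R) (q j : nat) :
  emb s (vertex (15 * q + j)) = emb (s * scale q) (vertex j).
Proof. by rewrite vertex_shift emb_hscale. Qed.

Lemma vertex_affine (j : nat) : affine (vertex j).
Proof. by []. Qed.

Lemma emb_raise (q : nat) (a : hpt) :
  emb (scale q) (hscale lambda a) = emb (scale q.+1) a.
Proof. by rewrite emb_hscale scaleS. Qed.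

Lemma emb_vertex_raise (q j : nat) :
  emb (scale q) (vertex (j + 15)) = emb (scale q.+1) (vertex j).
Proof. by rewrite addnC (vertex_shift 1) emb_raise. Qed.

Lemma arm_raise (q : nat) (e : edge) (b : bool) :
  (emb (scale q) (arm (raise e) b).1.2 = emb (scale q.+1) (arm e b).1.2) *
  (emb (scale q) (arm (raise e) b).2 = emb (scale q.+1) (arm e b).2).
Proof.
by case: b; (split; [exact: emb_vertex_raise|exact: emb_raise]).
Qed.

Lemma half_seg_coords (s : R) (h : half) (x : pt) :
  half_affine h -> half_seg s h x ->
  exists t : R, (0 <= t <= 1)%Re /\
    x.1 = (s * ((1 - t) * (IZR h.1.2.1.1 / IZR h.1.2.2)
                + t * (IZR h.2.1.1 / IZR h.2.2)))%Re /\
    x.2 = (s * ((1 - t) * (IZR h.1.2.1.2 / IZR h.1.2.2)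
                + t * (IZR h.2.1.2 / IZR h.2.2)))%Re.
Proof.
move=> /andP[/affine_gt0 p1 /affine_gt0 p2] [t [t0 [t1 [-> ->]]]].
by exists t; rewrite /emb /=; split; [lra|split; field; lra].
Qed.

Lemma quotient_ge (c x w : Z) : (0 < IZR w)%Re -> (c * w <= x)%Z ->
  (IZR c <= IZR x / IZR w)%Re.
Proof.
move=> w0 /IZR_le; rewrite mult_IZR => h.
by apply: (Rmult_le_reg_r (IZR w)) => //; field_simplify; lra.
Qed.

Lemma near_sound (s : R) (h : half) (x : pt) :
  half_affine h -> near h -> half_seg s h x ->
  (Rabs x.1 <= Rabs s * 10000 /\ Rabs x.2 <= Rabs s * 10000)%Re.
Proof.
move=> hp hn hx; have [t [t01 [-> ->]]] := half_seg_coords hp hx.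
move: hp hn => /andP[/affine_gt0 p1 /affine_gt0 p2].
have bound (y w : Z) : (0 < IZR w)%Re -> (Z.abs y <=? 10000 * w)%Z ->
    (-10000 <= IZR y / IZR w <= 10000)%Re.
  move=> w0 /Z.leb_le h0.
  have h1 := @quotient_ge (-10000) y w w0 ltac:(lia).
  have := @quotient_ge (-10000) (- y) w w0 ltac:(lia).
  by rewrite opp_IZR /Rdiv -Ropp_mult_distr_l; lra.
have mean (u v : R) : (-10000 <= u <= 10000)%Re -> (-10000 <= v <= 10000)%Re ->
    (Rabs (s * ((1 - t) * u + t * v)) <= Rabs s * 10000)%Re.
  move=> hu hv; rewrite Rabs_mult; apply: Rmult_le_compat_l; first exact: Rabs_pos.
  by apply: Rabs_le; nra.
move=> /andP[/andP[a1 a2] /andP[b1 b2]].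
by split; apply: mean; apply: bound.
Qed.

Lemma far_sound (s : R) (h : half) (x : pt) :
  half_affine h -> far h -> half_seg s h x ->
  (Rabs s * 60 <= Rabs x.1 \/ Rabs s * 60 <= Rabs x.2)%Re.
Proof.
move=> hp hf hx; have [t [t01 [-> ->]]] := half_seg_coords hp hx.
move: hp hf => /andP[/affine_gt0 p1 /affine_gt0 p2].
have mean (u v : R) : (60 <= u)%Re -> (60 <= v)%Re ->
    (Rabs s * 60 <= Rabs (s * ((1 - t) * u + t * v)))%Re.
  move=> hu hv; rewrite Rabs_mult; apply: Rmult_le_compat_l; first exact: Rabs_pos.
  by apply: Rle_trans (Rle_abs _); nra.
have meanN (u v : R) : (60 <= - u)%Re -> (60 <= - v)%Re ->
    (Rabs s * 60 <= Rabs (s * ((1 - t) * u + t * v)))%Re.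
  move=> hu hv; have := mean _ _ hu hv.
  rewrite -(Rabs_Ropp (s * ((1 - t) * u + t * v))).
  by congr (_ <= Rabs _)%Re; ring.
have neg (y w : Z) : (IZR (- y) / IZR w = - (IZR y / IZR w))%Re.
  by rewrite opp_IZR /Rdiv Ropp_mult_distr_l.
rewrite /far /= orbF => /or4P[] /andP[/Z.leb_le h1 /Z.leb_le h2];
  [left; apply: mean|left; apply: meanN|right; apply: mean|right; apply: meanN];
  by rewrite -?neg; apply: quotient_ge.
Qed.

Lemma near_far_disjoint (q r : nat) (h g : half) (x : pt) :
  (q.+2 <= r)%N -> half_affine h -> half_affine g -> near h -> far g ->
  half_seg (scale q) h x -> half_seg (scale r) g x -> False.
Proof.
move=> qr hp gp hn gf /(near_sound hp hn)[n1 n2] /(far_sound gp gf) f.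
have := scale_growth qr; have := Rabs_pos_lt _ (@scale_neq0 q).
by case: f; lra.
Qed.

(** * The stack as a graph, with positions and bends *)

Definition layer_edges (m q : nat) : seq edge :=
  if q == m then outer_layer else if q == 0 then first_layer else layer.

Definition edge_list (m : nat) : seq (nat * nat) :=
  [seq (15 * q + e.1, 15 * q + e.2) | q <- iota 0 m.+1, e <- map fst (layer_edges m q)].

Definition stack (m : nat) : rel 'I_(15 * m + 5) :=
  fun u v => ((val u, val v) \in edge_list m) || ((val v, val u) \in edge_list m).

Definition no_edge : edge := (0, 0, (0, 0, 1)%Z).

Definition position (m : nat) (w : 'I_(15 * m + 5)) : pt := emb 1 (vertex w).

(** For an edge, the smaller end [u] lies in the layer that lists it, so that layer is read off
    [u]. *)
Definition bend (m : nat) (u v : 'I_(15 * m + 5)) : pt :=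
  let q := u %/ 15 in
  let es := layer_edges m q in
  let i := index (u - 15 * q, v - 15 * q) (map fst es) in
  emb (scale q) (nth no_edge es i).2.

Lemma all_layer (p : pred edge) : all p first_layer -> all p layer.
Proof. by rewrite /first_layer all_cat => /andP[]. Qed.

Lemma all_layer_edges (p : pred edge) (m q : nat) :
  all p first_layer -> all p outer_layer -> all p (layer_edges m q).
Proof.
move=> p1 p2; rewrite /layer_edges; case: ifP => // _.
by case: ifP => // _; apply: all_layer.
Qed.

Lemma all_lower_layer_edges (p : pred edge) (m q : nat) :
  (q < m)%N -> all p first_layer -> all p (layer_edges m q).
Proof.
move=> qm p1; rewrite /layer_edges (ltn_eqF qm).
by case: ifP => // _; apply: all_layer.
Qed.

Lemma all_upper_layer_edges (p : pred edge) (m q : nat) :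
  (0 < q)%N -> all p layer -> all p outer_layer -> all p (layer_edges m q).
Proof.
by move=> q0 p1 p2; rewrite /layer_edges (gtn_eqF q0); case: ifP.
Qed.

(** * Crossings between edges *)

Lemma layer_edges_well_formed (m q : nat) : all well_formed (layer_edges m q).
Proof.
by apply: all_layer_edges;
  [exact: first_layer_well_formed|exact: outer_layer_well_formed].
Qed.

Lemma layer_edges_pairwise (m q : nat) :
  pairwise compatible_arms (map arms (layer_edges m q)).
Proof.
rewrite /layer_edges; case: ifP => _; first exact: outer_layer_compatible.
case: ifP => _; first exact: first_layer_compatible.
by have := first_layer_compatible; rewrite map_cat pairwise_cat => /and3P[].
Qed.

Lemma arm_affine (e : edge) (b : bool) : well_formed e -> half_affine (arm e b).
Proof. by case/and5P=> _ _ _ e2 _; rewrite /half_affine e2 andbT vertex_affine. Qed.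

Lemma arm_raise_affine (e : edge) (b : bool) :
  well_formed e -> half_affine (arm (raise e) b).
Proof. by case/and5P=> _ _ _ e2 _; rewrite /half_affine vertex_affine. Qed.

Lemma compatible_armsP (e f : edge) (b c : bool) :
  compatible_arms (arms e) (arms f) -> compatible (arm e b) (arm f c).
Proof. by case/and4P; case: b; case: c. Qed.

Lemma half_seg_raise (q : nat) (e : edge) (b : bool) (x : pt) :
  half_seg (scale q) (arm (raise e) b) x = half_seg (scale q.+1) (arm e b) x.
Proof. by rewrite /half_seg !arm_raise. Qed.

Lemma near_arm (e : edge) (b : bool) : near_edge e -> near (arm e b).
Proof. by case: b => /andP[]. Qed.

Lemma far_arm (e : edge) (b : bool) : far_edge e -> far (arm e b).
Proof. by case: b => /andP[]. Qed.

(** Equal layers are settled by the pairwise checks, consecutive ones by the checks with [raise],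
    and all others by [near] and [far]. *)
Lemma arms_crossing (m q r i j : nat) (b c : bool) (x : pt) :
  (r <= m)%N -> (i < size (layer_edges m q))%N -> (j < size (layer_edges m r))%N ->
  (q < r)%N || (q == r) && (i < j)%N ->
  let h := arm (nth no_edge (layer_edges m q) i) b in
  let g := arm (nth no_edge (layer_edges m r) j) c in
  half_seg (scale q) h x -> half_seg (scale r) g x ->
  15 * q + h.1.1 = 15 * r + g.1.1 /\ x = emb (scale q) h.1.2 \/
  perp (emb (scale q) h.1.2) (emb (scale q) h.2) (emb (scale r) g.1.2) (emb (scale r) g.2).
Proof.
move=> rm iq jr lt_ij h g hx gx.
have eh : well_formed (nth no_edge (layer_edges m q) i).
  exact: (all_nthP no_edge (layer_edges_well_formed m q)).
have eg : well_formed (nth no_edge (layer_edges m r) j).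
  exact: (all_nthP no_edge (layer_edges_well_formed m r)).
have idP e f k l : (arm e k).1.1 = (arm f l).1.1 -> (arm e k).1.2 = (arm f l).1.2.
  by rewrite /arm /= => ->.
have q0 := @scale_neq0 q.
case/orP: lt_ij => [|/andP[/eqP qr ij]]; last first.
  move: jr @g gx eg; rewrite -{r rm}qr => jr g gx eg.
  have := layer_edges_pairwise m q.
  rewrite pairwise_map => /(pairwiseP no_edge) /(_ i j iq jr ij) /compatible_armsP.
  move=> /(_ b c) /(compatible_sound q0 (arm_affine b eh) (arm_affine c eg) (idP _ _ _ _)).
  by move=> /(_ x hx gx) [[-> ->]|]; [left|right].
rewrite leq_eqVlt => /orP[/eqP qr|qr]; last first.
  have qm : (q < m)%N by apply: leq_trans rm; apply: ltnW.
  case: (near_far_disjoint qr (arm_affine b eh) (arm_affine c eg) _ _ hx gx).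
    apply: near_arm.
    exact: (all_nthP no_edge (all_lower_layer_edges qm first_layer_near)).
  apply: far_arm.
  have r0 : (0 < r)%N by apply: leq_trans qr.
  exact: (all_nthP no_edge (all_upper_layer_edges m r0 layer_far outer_layer_far)).
move: rm jr @g gx eg; rewrite -{r}qr => qm jr g gx eg.
have comp : compatible h (arm (raise (nth no_edge (layer_edges m q.+1) j)) c).
  apply: compatible_armsP.
  (* Layer [q] is not the last one and layer [q.+1] is not the first, so the two finite checks
     exhaust the possibilities. *)
  have : all (fun e => all (fun f => compatible_arms (arms e) (arms (raise f)))
               (layer_edges m q.+1)) (layer_edges m q).
    apply: (all_lower_layer_edges qm); apply/(all_nthP no_edge) => k k1.
    apply: (all_upper_layer_edges m (ltn0Sn q)).
      have := layer_layer_compatible; rewrite allrel_mapl !allrel_mapr.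
      by move=> /(all_nthP no_edge) /(_ k k1).
    have := layer_outer_compatible; rewrite allrel_mapl !allrel_mapr.
    by move=> /(all_nthP no_edge) /(_ k k1).
  by move/(all_nthP no_edge)/(_ i iq)/(all_nthP no_edge)/(_ j jr).
have gx' := gx; rewrite -half_seg_raise in gx'.
have := compatible_sound q0 (arm_affine b eh) (arm_raise_affine c eg)
  (idP _ _ _ _) comp hx gx'.
rewrite !arm_raise => -[[id ->]|]; [left; split=> //|by right].
by rewrite id /g mulnS; case: (c); rewrite /= addnA (addnC _ 15) addnA.
Qed.

(** * Vertices against edges *)

Lemma vertex_half_seg (s : R) (j : nat) :
  half_seg s (vertex_half j) (emb s (vertex j)).
Proof. by exists 0%Re; rewrite !Rmult_0_l !Rplus_0_r; split; [lra|split; [lra|]]. Qed.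

Lemma vertex_near (j : nat) : (j < 15)%N -> near (vertex_half j).
Proof.
by move=> j15; have /allP/(_ j) := vertices_near_far; rewrite mem_iota => /(_ j15) /andP[].
Qed.

Lemma vertex_far (j : nat) : (j < 15)%N -> far (vertex_half j).
Proof.
by move=> j15; have /allP/(_ j) := vertices_near_far; rewrite mem_iota => /(_ j15) /andP[].
Qed.

Lemma vertex_half_affine (j : nat) : half_affine (vertex_half j).
Proof. by rewrite /half_affine vertex_affine. Qed.

Lemma avoids_sound (s : R) (e : edge) (b : bool) (n j : nat) :
  s <> 0%Re -> (forall c, half_affine (arm e c)) -> avoids (iota 0 n) e ->
  (j < n)%N -> j <> e.1.1 -> j <> e.1.2 ->
  half_seg s (arm e b) (emb s (vertex j)) -> False.
Proof.
move=> s0 he /allP /(_ j); rewrite mem_iota => av jn /eqP j1 /eqP j2 hx.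
move: (av jn); rewrite (negbTE j1) (negbTE j2) => /andP[s1 s2].
have vx := vertex_half_seg s j; move: hx.
case: b => hx.
  exact: (separated_sound s0 (he true) (vertex_half_affine j) s1 hx vx).
exact: (separated_sound s0 (he false) (vertex_half_affine j) s2 hx vx).
Qed.

(** The cases are those of the crossings, except that the layer of the vertex may lie on either side
    of that of the edge. *)
Lemma arm_vertex (m q r i j : nat) (b : bool) :
  (q <= m)%N -> (r <= m)%N -> (i < size (layer_edges m q))%N -> (j < 15)%N ->
  (r = m -> j < 5)%N ->
  let e := nth no_edge (layer_edges m q) i in
  15 * r + j <> 15 * q + e.1.1 -> 15 * r + j <> 15 * q + e.1.2 ->
  half_seg (scale q) (arm e b) (emb (scale r) (vertex j)) -> False.
Proof.
move=> qm rm iq j15 jm e n1 n2 hx.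
have he : well_formed e by exact: (all_nthP no_edge (layer_edges_well_formed m q)).
have vx := vertex_half_seg (scale r) j.
have jaff := vertex_half_affine j.
case: (ltngtP q r) => qr; last first.
- move: rm jm n1 n2 hx vx; rewrite -{r}qr => _ jm n1 n2 hx vx.
  have {}n1 : j <> e.1.1 by move=> h; apply: n1; rewrite h.
  have {}n2 : j <> e.1.2 by move=> h; apply: n2; rewrite h.
  have aff c : half_affine (arm e c) by exact: arm_affine.
  case: (ltngtP q m) qm => // [ltqm _|eqm _].
    have av := all_nthP no_edge (all_lower_layer_edges ltqm first_layer_avoids) i iq.
    apply: (avoids_sound (@scale_neq0 q) aff av _ n1 n2 hx).
    exact: (leq_trans j15).
  have av : avoids (iota 0 5) e.
    move: iq; rewrite /e /layer_edges eqm eqxx.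
    exact: (all_nthP no_edge outer_layer_avoids).
  exact: (avoids_sound (@scale_neq0 q) aff av (jm eqm) n1 n2 hx).
- have q0 : (0 < q)%N by apply: leq_trans qr.
  move: qr; rewrite leq_eqVlt => /orP[/eqP rq|rq]; last first.
    apply: (near_far_disjoint rq jaff (arm_affine b he) (vertex_near j15) _ vx hx).
    apply: far_arm.
    exact: (all_nthP no_edge (all_upper_layer_edges m q0 layer_far outer_layer_far)).
  (* At the scale of layer [r], an edge of layer [r.+1] is a raised one. *)
  have av : avoids (iota 0 15) (raise e).
    exact: (all_nthP no_edge
      (all_upper_layer_edges m q0 raised_layer_avoids raised_outer_layer_avoids) i iq).
  have aff c : half_affine (arm (raise e) c) by exact: arm_raise_affine.
  move: hx; rewrite -{1}rq -half_seg_raise.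
  apply: (avoids_sound (@scale_neq0 r) aff av j15) => h.
    by apply: n1; rewrite h -rq mulnS /= addnA (addnC _ 15) addnA.
  by apply: n2; rewrite h -rq mulnS /= addnA (addnC _ 15) addnA.
have ltqm : (q < m)%N by apply: leq_trans rm.
move: qr; rewrite leq_eqVlt => /orP[/eqP qr|qr]; last first.
  apply: (near_far_disjoint qr (arm_affine b he) jaff _ (vertex_far j15) hx vx).
  apply: near_arm.
  exact: (all_nthP no_edge (all_lower_layer_edges ltqm first_layer_near)).
have aff c : half_affine (arm e c) by exact: arm_affine.
have av := all_nthP no_edge (all_lower_layer_edges ltqm first_layer_avoids) i iq.
(* At the scale of layer [q], the vertex has number [j + 15], which is below 30. *)
move: hx; rewrite -{1}qr -emb_vertex_raise.
apply: (avoids_sound (@scale_neq0 q) aff av); first by rewrite addnC (ltn_add2l 15 j 15).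
  by move=> h; apply: n1; rewrite -qr mulnS -h (addnC 15) -addnA (addnC 15).
by move=> h; apply: n2; rewrite -qr mulnS -h (addnC 15) -addnA (addnC 15).
Qed.

(** * Distinctness of the vertex positions *)

Lemma position_scale (m : nat) (w : 'I_(15 * m + 5)) (q j : nat) :
  val w = 15 * q + j -> position w = emb (scale q) (vertex j).
Proof. by rewrite /position => ->; rewrite emb_vertex_shift Rmult_1_l. Qed.

Lemma layer_decomposition (m n : nat) : (n < 15 * m + 5)%N ->
  exists q j : nat, [/\ n = 15 * q + j, (q <= m)%N, (j < 15)%N & (q = m -> j < 5)%N].
Proof.
move=> lt; have e : n = 15 * (n %/ 15) + n %% 15 by rewrite mulnC; exact: divn_eq.
exists (n %/ 15), (n %% 15); split=> //; last first.
- by move=> qm; move: lt; rewrite {1}e qm ltn_add2l.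
- by rewrite ltn_mod.
rewrite -ltnS ltn_divLR // mulSn mulnC addnC; apply: (leq_trans lt).
by rewrite leq_add2l.
Qed.

Lemma emb_inj (s : R) (j k : nat) :
  s <> 0%Re -> emb s (vertex j) = emb s (vertex k) -> same_point (vertex j) (vertex k).
Proof.
move=> s0 [e1 e2].
have inj (y z : Z) : (s * IZR y / 1 = s * IZR z / 1)%Re -> y = z.
  by rewrite /Rdiv !Rinv_1 !Rmult_1_r => /(Rmult_eq_reg_l s) /(_ s0) /eq_IZR.
by apply/andP; split; apply/Z.eqb_eq; apply: inj.
Qed.

Lemma vertex_inj (s : R) (j k : nat) : s <> 0%Re -> (j < 30)%N -> (k < 30)%N ->
  emb s (vertex j) = emb s (vertex k) -> j = k.
Proof.
move=> s0 j30 k30 /(emb_inj s0) same.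
have /allP/(_ j) := vertices_distinct; rewrite mem_iota => /(_ j30) /allP /(_ k).
by rewrite mem_iota => /(_ k30); rewrite same orbF => /eqP.
Qed.

(** Vertices of equal or consecutive layers are among 30 scaled ones known to be distinct; others
    are separated as degenerate halves. *)
Lemma position_inj (m : nat) : injective (@position m).
Proof.
have aux (q r j k : nat) : (q <= r)%N -> (j < 15)%N -> (k < 15)%N ->
    emb (scale q) (vertex j) = emb (scale r) (vertex k) -> 15 * q + j = 15 * r + k.
  move=> qr j15 k15 e; move: qr; rewrite leq_eqVlt => /orP[/eqP qr|].
    rewrite -qr; congr (_ + _); rewrite -qr in e.
    apply: vertex_inj e; [exact: scale_neq0|exact: leq_trans j15 _|exact: leq_trans k15 _].
  rewrite leq_eqVlt => /orP[/eqP qr|qr].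
    move: e; rewrite -qr -emb_vertex_raise => e.
    have -> : j = k + 15.
      apply: vertex_inj e; [exact: scale_neq0|exact: leq_trans j15 _|].
      by rewrite addnC (ltn_add2l 15 k 15).
    by rewrite mulnS (addnC 15) -addnA (addnC 15).
  case: (near_far_disjoint qr (vertex_half_affine j) (vertex_half_affine k)
    (vertex_near j15) (vertex_far k15) (vertex_half_seg _ _)).
  by rewrite e; exact: vertex_half_seg.
move=> u v; have [q [j [eu _ j15 _]]] := layer_decomposition (ltn_ord u).
have [r [k [ev _ k15 _]]] := layer_decomposition (ltn_ord v).
rewrite (position_scale eu) (position_scale ev) => e; apply: val_inj.
transitivity (15 * q + j) => //; transitivity (15 * r + k); last by [].
case: (leqP q r) => qr; first exact: aux e.
by symmetry; apply: aux (esym e); first exact: ltnW.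
Qed.

(** * Transfer from lists of edges to the drawing *)

Definition drawn_as (m : nat) (u v : 'I_(15 * m + 5)) (q i : nat) : Prop :=
  let e := nth no_edge (layer_edges m q) i in
  [/\ (q <= m)%N, (i < size (layer_edges m q))%N,
      val u = 15 * q + e.1.1, val v = 15 * q + e.1.2
    & bend u v = emb (scale q) e.2].

(** The last clause matches the entry found with the lookup made by [bend]. *)
Lemma edge_listP (m x y : nat) : (x, y) \in edge_list m ->
  exists q i : nat, let e := nth no_edge (layer_edges m q) i in
  [/\ (q <= m)%N, (i < size (layer_edges m q))%N, x = 15 * q + e.1.1,
      y = 15 * q + e.1.2 & i = index (x - 15 * q, y - 15 * q) (map fst (layer_edges m q))].
Proof.
case/allpairsPdep=> q [k [qm kq [-> ->]]].
set es := map fst _ in kq *.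
have iq : (index k es < size (layer_edges m q))%N by rewrite -(size_map fst) index_mem.
exists q, (index k es).
have e : (nth no_edge (layer_edges m q) (index k es)).1 = k.
  by rewrite -(nth_map no_edge (0, 0) fst iq) nth_index.
rewrite /= e !addKn -surjective_pairing; split=> //.
by move: qm; rewrite mem_iota.
Qed.

Lemma well_formed_nth (m q i : nat) : (i < size (layer_edges m q))%N ->
  let e := nth no_edge (layer_edges m q) i in
  [/\ (e.1.1 < e.1.2)%N, (e.1.1 < 15)%N, (e.1.2 < 20)%N
    & hinge e.2 (vertex e.1.1) (vertex e.1.2)].
Proof.
move=> iq; have := all_nthP no_edge (layer_edges_well_formed m q) i iq.
by case/and5P.
Qed.

Lemma edge_list_lt (m x y : nat) : (x, y) \in edge_list m -> (x < y)%N.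
Proof.
case/edge_listP=> q [i [_ iq -> -> _]]; rewrite ltn_add2l.
by have [] := well_formed_nth iq.
Qed.

Lemma stack_is_edge (m : nat) (u v : 'I_(15 * m + 5)) :
  is_edge (@stack m) u v = ((val u, val v) \in edge_list m).
Proof.
apply/andP/idP => [[uv /orP[//|/edge_list_lt]]|uv].
  by rewrite ltnNge (ltnW uv).
by split; [exact: edge_list_lt uv|rewrite /stack uv].
Qed.

Lemma stack_simple (m : nat) : simple_graph (@stack m).
Proof.
split=> [u|u v]; last by rewrite /stack orbC.
by apply/negP => /orP[] /edge_list_lt; rewrite ltnn.
Qed.

Lemma drawn_asP (m : nat) (u v : 'I_(15 * m + 5)) :
  is_edge (@stack m) u v -> exists q i : nat, drawn_as u v q i.
Proof.
rewrite stack_is_edge => /edge_listP[q [i [qm iq eu ev ei]]].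
exists q, i; split=> //; rewrite /bend.
have -> : val u %/ 15 = q.
  have [_ lt15 _ _] := well_formed_nth iq.
  by rewrite eu mulnC divnMDl // divn_small // addn0.
by rewrite -ei.
Qed.

Lemma perp_sym (a b c d : pt) : perp a b c d -> perp c d a b.
Proof. by rewrite /perp; lra. Qed.

Lemma perp_rev (a b c d : pt) : perp a b c d -> perp b a c d.
Proof. by rewrite /perp; lra. Qed.

(** An [arm] always runs from vertex to bend, whereas the second [piece] of an edge runs from bend
    to vertex and has to be reversed. *)
Lemma drawn_piece (m : nat) (u v : 'I_(15 * m + 5)) (q i : nat) (b : bool) :
  drawn_as u v q i ->
  let h := arm (nth no_edge (layer_edges m q) i) b in
  let p := piece (@position m) (@bend m) u v b in
  [/\ forall x, on_seg p.1 p.2 x -> half_seg (scale q) h x,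
      forall c d, perp (emb (scale q) h.1.2) (emb (scale q) h.2) c d -> perp p.1 p.2 c d,
      val (if b then u else v) = 15 * q + h.1.1
    & position (if b then u else v) = emb (scale q) h.1.2].
Proof.
move=> [qm iq eu ev eb] h p; rewrite /p /h /piece.
have pu := position_scale eu; have pv := position_scale ev.
by case: b h p => h p; rewrite /half_seg /= eb ?pu ?pv; split=> //;
  [move=> x /on_seg_sym|move=> c d /perp_rev].
Qed.

Lemma drawn_crossing (m : nat) (u v u' v' : 'I_(15 * m + 5)) (q i r j : nat)
    (b c : bool) (x : pt) :
  drawn_as u v q i -> drawn_as u' v' r j -> (q < r)%N || (q == r) && (i < j)%N ->
  let p := piece (@position m) (@bend m) u v b in
  let p' := piece (@position m) (@bend m) u' v' c in
  on_seg p.1 p.2 x -> on_seg p'.1 p'.2 x ->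
  (exists w, (w = u \/ w = v) /\ (w = u' \/ w = v') /\ x = position w)
  \/ perp p.1 p.2 p'.1 p'.2.
Proof.
move=> d d' lt p p' px px'.
have [seg per ew pw] := drawn_piece b d; have [seg' per' ew' _] := drawn_piece c d'.
have [_ iq _ _ _] := d; have [rm jr _ _ _] := d'.
case: (arms_crossing rm iq jr lt (seg x px) (seg' x px')) => [[id ex]|pp]; last first.
  by right; apply: per; apply: perp_sym; apply: per'; apply: perp_sym.
have ww : (if b then u else v) = if c then u' else v'.
  by apply: val_inj; rewrite ew ew' id.
left; exists (if b then u else v); split; first by case: (b); [left|right].
split; last by rewrite pw.
by rewrite ww; case: (c); [left|right].
Qed.

Lemma stack_drawing (m : nat) : RAC1_drawing (@stack m) (@position m) (@bend m).
Proof.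
split; first exact: position_inj.
split.
  move=> u v /drawn_asP[q [i d]] w wu wv b.
  have [seg _ _ _] := drawn_piece b d; have [qm iq eu ev _] := d.
  have [r [j [ew rm j15 jm]]] := layer_decomposition (ltn_ord w).
  rewrite (position_scale ew) => /seg; apply: arm_vertex => // h.
    by apply: wu; apply: val_inj; rewrite eu -h.
  by apply: wv; apply: val_inj; rewrite ev -h.
split.
  move=> u v /drawn_asP[q [i [qm iq eu ev eb]]] x.
  rewrite (position_scale eu) (position_scale ev) eb => /on_seg_sym.
  have /and5P[_ _ _ e2 hi] := all_nthP no_edge (layer_edges_well_formed m q) i iq.
  exact: (hinge_sound (@scale_neq0 q) e2 (vertex_affine _) (vertex_affine _) hi).
move=> u v u' v' /drawn_asP[q [i d]] /drawn_asP[r [j d']] ne b c x px px'.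
case lt : ((q < r)%N || (q == r) && (i < j)%N).
  exact: drawn_crossing d d' lt px px'.
(* Equal places in the lists would give equal edges, against [ne]; so the lexicographic comparison
   is strict. *)
have gt : (r < q)%N || (r == q) && (j < i)%N.
  move: lt; case: (ltngtP q r) => //= qr; case: (ltngtP i j) => //= ij _.
  case: ne; have [_ _ eu ev _] := d; have [_ _ eu' ev' _] := d'.
  by congr (_, _); apply: val_inj; rewrite ?eu ?ev ?eu' ?ev' qr ij.
case: (drawn_crossing d' d gt px' px) => [[w [w1 [w2 ->]]]|/perp_sym]; last by right.
by left; exists w.
Qed.

(** * Counting the edges *)

Lemma edge_list_bound (m x y : nat) : (x, y) \in edge_list m -> (y < 15 * m + 5)%N.
Proof.
case/edge_listP=> q [i [qm iq _ -> _]].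
have [_ _ lt20 _] := well_formed_nth iq.
move: qm; rewrite leq_eqVlt => /orP[/eqP qm|qm].
  rewrite qm ltn_add2l; move: iq; rewrite /layer_edges qm eqxx => iq.
  exact: (all_nthP no_edge outer_layer_lt5).
(* The bound 20 on ends within a layer is 15 + 5. *)
apply: (@leq_trans (15 * q.+1 + 5)); last by rewrite leq_add2r leq_mul2l.
by rewrite mulnS (addnC 15) -addnA ltn_add2l.
Qed.

Lemma layer_edges_uniq (m q : nat) : uniq (map fst (layer_edges m q)).
Proof.
rewrite /layer_edges; case: ifP => _; first exact: outer_layer_uniq.
case: ifP => _; first exact: first_layer_uniq.
by have := first_layer_uniq; rewrite map_cat cat_uniq => /and3P[].
Qed.

(** Different layers share no edge, since the quotient of the smaller end by 15 is the layer. *)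
Lemma edge_list_uniq (m : nat) : uniq (edge_list m).
Proof.
apply: allpairs_uniq_dep; first exact: iota_uniq.
  by move=> q _; exact: layer_edges_uniq.
move=> _ _ /allpairsPdep[q [k [_ kq ->]]] /allpairsPdep[r [l [_ lr ->]]] /= [e1 e2].
have lt15 n f : f \in map fst (layer_edges m n) -> (f.1 < 15)%N.
  case/(nthP (0, 0)) => i; rewrite size_map => ni <-.
  by rewrite (nth_map no_edge) //; have [] := well_formed_nth ni.
have qr : q = r.
  have := congr1 (divn^~ 15) e1.
  rewrite /= !(mulnC 15) !divnMDl // (divn_small (lt15 _ _ kq)).
  by rewrite (divn_small (lt15 _ _ lr)) !addn0.
move: e1 e2; rewrite -qr => /addnI e1 /addnI e2.
by congr existT; rewrite (surjective_pairing k) e1 e2 -surjective_pairing.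
Qed.

(** Layer 0 has 80 edges, each of the m - 1 middle layers 75, and the last one 10. *)
Lemma size_edge_list (m : nat) : (0 < m)%N -> size (edge_list m) = 75 * m + 15.
Proof.
have [s1 s2 s3] := size_layers.
case: m => // m _; rewrite size_allpairs_dep sumnE big_map.
rewrite (_ : iota 0 m.+2 = index_iota 0 m.+2) //.
rewrite big_nat_recl // big_nat_recr //= !size_map.
rewrite {2}/layer_edges eqxx s3 (eq_big_nat _ _ (F2 := fun=> 75)); last first.
  by move=> q /andP[_ qm]; rewrite size_map /layer_edges eqSS (ltn_eqF qm).
by rewrite sum_nat_const_nat subn0 (mulnC m) addnCA (mulnS 75 m) (addnC 75) -addnA.
Qed.

Lemma num_edges_stack (m : nat) : num_edges (@stack m) = size (edge_list m).
Proof.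
rewrite /num_edges cardE.
set s := enum _; set f := fun p : 'I_(15 * m + 5) * 'I_(15 * m + 5) => (val p.1, val p.2).
rewrite -(size_map f); apply: perm_size; apply: uniq_perm.
- by rewrite map_inj_uniq ?enum_uniq // => -[a b] [c d] [/val_inj -> /val_inj ->].
- exact: edge_list_uniq.
move=> [x y]; apply/mapP/idP => [[[u v]]|xy].
  by rewrite mem_enum inE stack_is_edge => uv ->.
have ylt := edge_list_bound xy; have xlt := ltn_trans (edge_list_lt xy) ylt.
by exists (Ordinal xlt, Ordinal ylt); rewrite // mem_enum inE stack_is_edge.
Qed.

Theorem theorem2 :
  forall N : nat, exists n : nat, (N < n)%N /\
    exists E : rel 'I_n, simple_graph E /\ (num_edges E + 10 = 5 * n)%N /\ RAC1_graph E.
Proof.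
(* A stack of [N.+1] dodecahedra is never empty, as the edge count requires. *)
move=> N; exists (15 * N.+1 + 5); split.
  exact: leq_trans (leq_pmull N.+1 (isT : 0 < 15)) (leq_addr 5 _).
exists (@stack N.+1); split; first exact: stack_simple.
split; last by exists (@position N.+1), (@bend N.+1); exact: stack_drawing.
by rewrite num_edges_stack size_edge_list // -addnA mulnDr mulnA.
Qed.
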